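(* Let $\lambda_0$ be a double eigenvalue of the Sturm--Liouville problem $-y''+q(x)y=\lambda y$ $(0<x<1)$, $y(0)\cos\beta=y'(0)\sin\beta$, $(a\lambda+b)y(1)=(c\lambda+d)y'(1)$, where $q$ is real-valued and continuous on $[0,1]$, $a,b,c,d\in\mathbb{R}$, $ad-bc<0$ and $0\le\beta<\pi$. Let $\omega$ be its characteristic function, let $y_0$ be the eigenfunction, let $y_1=\tilde y_1+Cy_0$ be the first associated function with constant $C$, and let $y_1^{*}=y_1+C_1y_0$, where $C_1$ is the specific constant defined in the context. Then $$\mathfrak{A}(y_1^{*})=0\quad\text{if and only if}\quad C=-\frac{\omega'''(\lambda_0)}{3\,\omega''(\lambda_0)}.$$
   Context: Setting. Let $q$ be a real-valued continuous function on $[0,1]$, let $a,b,c,d$ be reals with $ad-bc<0$, and let $0\le\beta<\pi$. Consider the problem $$-y''+q(x)y=\lambda y\ (0<x<1),\qquad y(0)\cos\beta=y'(0)\sin\beta,\qquad (a\lambda+b)y(1)=(c\lambda+d)y'(1).$$ Let $y(x,\lambda)$ be the solution of $-y''+q(x)y=\lambda y$ with initial data $y(0,\lambda)=\sin\beta$, $y'(0,\lambda)=\cos\beta$ (a prime on $y$-functions denotes $d/dx$). The characteristic function is $$\omega(\lambda)=(a\lambda+b)\,y(1,\lambda)-(c\lambda+d)\,y'(1,\lambda),$$ whose derivatives $\omega',\omega'',\omega''',\dots$ are taken with respect to $\lambda$. Eigenvalues are the zeros of $\omega$, with multiplicity the order of the zero; $\lambda_0$ is a double eigenvalue if $\omega(\lambda_0)=\omega'(\lambda_0)=0\ne\omega''(\lambda_0)$.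 Root functions. $y_0(x)=y(x,\lambda_0)$ is the eigenfunction; $\tilde y_1(x)=\frac{\partial y}{\partial\lambda}(x,\lambda_0)$; and $y_1=\tilde y_1+Cy_0$, with $C$ a constant, is the first associated function (it satisfies $-y_1''+qy_1=\lambda_0y_1+y_0$, $y_1(0)\cos\beta=y_1'(0)\sin\beta$, $(a\lambda_0+b)y_1(1)+ay_0(1)=(c\lambda_0+d)y_1'(1)+cy_0'(1)$). With the same constant $C$ put $\hat y_1=y_1+Cy_0$. The quantities $\mathfrak{A}$. Define $$\mathfrak{A}(y_0)=\begin{cases}\dfrac{y_0(1)}{c\lambda_0+d}, & c\lambda_0+d\neq0,\\[8pt] \dfrac{y_0'(1)}{a\lambda_0+b}, & c\lambda_0+d=0,\end{cases}$$ and, for $u$ equal to any of $y_1,\hat y_1,y_1^{*}$, $$\mathfrak{A}(u)=\begin{cases}\dfrac{u(1)}{c\lambda_0+d}-\dfrac{c\,y_0(1)}{(c\lambda_0+d)^2}, & c\lambda_0+d\neq0,\\[8pt] \dfrac{u'(1)}{a\lambda_0+b}-\dfrac{a\,y_0'(1)}{(a\lambda_0+b)^2}, & c\lambda_0+d=0.\end{cases}$$ The function $y_1^{*}$. $y_1^{*}=y_1+C_1y_0$, where $$C_1=-\frac{\mathfrak{A}(\hat y_1)\,\frac{\omega''(\lambda_0)}{2}+\mathfrak{A}(y_0)\,\frac{\omega'''(\lambda_0)}{6}}{\mathfrak{A}(y_0)\,\frac{\omega''(\lambda_0)}{2}}.$$ *)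

(* Defs.v *)
From Stdlib Require Import Reals Lra.
From Coquelicot Require Import Coquelicot.
Open Scope R_scope.

Definition I01 (x : R) : Prop := 0 <= x <= 1.

(* Derivative of a complex-valued function of a real variable relative to
   [0,1]: this is Coquelicot's [is_derive] with the neighbourhoods restricted
   to [0,1], hence one-sided at 0 and 1.  Only the values of f on [0,1] matter
   when x is in [0,1]. *)
Definition is_derive01 (f : R -> C) (x : R) (l : C) : Prop :=
  @filterdiff R_AbsRing R_NormedModule C_R_NormedModule f
    (within I01 (locally x))
    (fun h : R => @scal R_AbsRing C_R_NormedModule h l).

Definition ex_derive01 (f : R -> C) (x : R) : Prop :=
  exists l : C, is_derive01 f x l.

(* Total operator; only meaningful where [ex_derive01] holds. *)
Definition derive01 (f : R -> C) (x : R) : C :=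
  @iota C_CompleteNormedModule (is_derive01 f x).

Lemma norm_C_R (z : C) : @norm R_AbsRing C_R_NormedModule z = Cmod z.
Proof.
destruct z as [u v]; unfold Cmod; simpl fst; simpl snd.
rewrite <- (pow2_abs u), <- (pow2_abs v); reflexivity.
Qed.

Lemma is_derive01_uniq (f : R -> C) (x : R) (l1 l2 : C) :
  I01 x -> is_derive01 f x l1 -> is_derive01 f x l2 -> l1 = l2.
Proof.
intros Hx [_ H1] [_ H2].
assert (Lx : @is_filter_lim R_UniformSpace (within I01 (locally x)) x).
{ intros P HP; unfold within; revert HP; apply filter_imp; auto. }
specialize (H1 x Lx); specialize (H2 x Lx).
apply Ceq_minus, Cmod_eq_0.
apply Rle_antisym; [| apply Cmod_ge_0].
apply le_epsilon; intros eps Heps; rewrite Rplus_0_l.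
assert (Heps2 : 0 < eps / 2) by lra.
specialize (H1 (mkposreal _ Heps2)); specialize (H2 (mkposreal _ Heps2)).
unfold within in H1, H2; simpl in H1, H2.
destruct (filter_and _ _ H1 H2) as [delta Hd].
assert (Ht : exists t, t <> x /\ I01 t /\ Rabs (t - x) < delta).
{ pose proof (cond_pos delta) as Hdel.
  set (s := Rmin (1 / 2) (delta / 2)).
  assert (Hs : 0 < s <= 1 / 2 /\ s < delta).
  { unfold s, Rmin; destruct (Rle_dec (1 / 2) (delta / 2)); lra. }
  destruct (Rle_dec x (1 / 2)) as [Hc | Hc]; unfold I01 in *.
  - exists (x + s); repeat split; try lra.
    replace (x + s - x) with s by ring; rewrite Rabs_pos_eq; lra.
  - exists (x - s); repeat split; try lra.
    replace (x - s - x) with (- s) by ring.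
    rewrite Rabs_Ropp, Rabs_pos_eq; lra. }
destruct Ht as [t [Htx [Ht Htd]]].
destruct (Hd t Htd) as [A1 A2]; specialize (A1 Ht); specialize (A2 Ht).
rewrite norm_C_R in A1.
change (Cmod (f t - f x - @scal R_AbsRing C_R_NormedModule (t - x)%R l1)%C
        <= eps / 2 * Rabs (t - x)) in A1.
rewrite norm_C_R in A2.
change (Cmod (f t - f x - @scal R_AbsRing C_R_NormedModule (t - x)%R l2)%C
        <= eps / 2 * Rabs (t - x)) in A2.
rewrite scal_R_Cmult in A1, A2.
assert (Hpos : 0 < Rabs (t - x)) by (apply Rabs_pos_lt; lra).
apply Rmult_le_reg_l with (1 := Hpos).
rewrite <- (Cmod_R (t - x)) at 1; rewrite <- Cmod_mult.
replace (RtoC (t - x) * (l1 - l2))%C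
  with ((f t - f x - RtoC (t - x) * l2)
        + - (f t - f x - RtoC (t - x) * l1))%C by ring.
eapply Rle_trans; [apply Cmod_triangle | rewrite Cmod_opp; lra].
Qed.

Lemma is_derive01_unique (f : R -> C) (x : R) (l : C) :
  I01 x -> is_derive01 f x l -> derive01 f x = l.
Proof.
intros Hx H; apply (@iota_unique C_AbsRing C_CompleteNormedModule); auto.
intros l' H'; exact (is_derive01_uniq f x l' l Hx H' H).
Qed.

Definition C_derive_n (n : nat) (f : C -> C) : C -> C := Nat.iter n C_derive f.

(* f is twice differentiable on [0,1] and -f'' + q f = lam f on (0,1). *)
Definition solves_SL (q : R -> R) (lam : C) (f : R -> C) : Prop :=
  (forall x : R, I01 x -> ex_derive01 f x) /\
  (forall x : R, I01 x -> ex_derive01 (derive01 f) x) /\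
  (forall x : R, 0 < x < 1 ->
     (- derive01 (derive01 f) x + RtoC (q x) * f x)%C = (lam * f x)%C).

(* [y x lam] is the solution y(x,lam) with y(0,lam) = sin beta and
   y'(0,lam) = cos beta, for every complex lam. *)
Definition is_initial_solution (q : R -> R) (beta : R) (y : R -> C -> C) : Prop :=
  forall lam : C,
    solves_SL q lam (fun x => y x lam) /\
    y 0 lam = RtoC (sin beta) /\
    derive01 (fun x => y x lam) 0 = RtoC (cos beta).

Definition char_fun (a b c d : R) (y : R -> C -> C) (lam : C) : C :=
  ((RtoC a * lam + RtoC b) * y 1%R lam
   - (RtoC c * lam + RtoC d) * derive01 (fun x => y x lam) 1)%C.

Definition double_eigenvalue (a b c d : R) (y : R -> C -> C) (lam0 : C) : Prop :=
  let w := char_fun a b c d y in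
  w lam0 = RtoC 0 /\ C_derive_n 1 w lam0 = RtoC 0 /\
  C_derive_n 2 w lam0 <> RtoC 0.

Definition eigenfun (y : R -> C -> C) (lam0 : C) : R -> C :=
  fun x => y x lam0.

Definition ytilde1 (y : R -> C -> C) (lam0 : C) : R -> C :=
  fun x => C_derive (fun lam => y x lam) lam0.

(* y1 = ytilde1 + K y0; the constant is called K since C is the complex field. *)
Definition assoc_fun (y : R -> C -> C) (lam0 K : C) : R -> C :=
  fun x => (ytilde1 y lam0 x + K * eigenfun y lam0 x)%C.

Definition yhat1 (y : R -> C -> C) (lam0 K : C) : R -> C :=
  fun x => (assoc_fun y lam0 K x + K * eigenfun y lam0 x)%C.

Definition frakA0 (a b c d : R) (lam0 : C) (y0 : R -> C) : C :=
  let p := (RtoC a * lam0 + RtoC b)%C in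
  let r := (RtoC c * lam0 + RtoC d)%C in
  if Ceq_dec r (RtoC 0)
  then (derive01 y0 1 / p)%C
  else (y0 1%R / r)%C.

(* Used for u one of y1, yhat1, y1star. *)
Definition frakA1 (a b c d : R) (lam0 : C) (y0 u : R -> C) : C :=
  let p := (RtoC a * lam0 + RtoC b)%C in
  let r := (RtoC c * lam0 + RtoC d)%C in
  if Ceq_dec r (RtoC 0)
  then (derive01 u 1 / p - RtoC a * derive01 y0 1 / (p * p))%C
  else (u 1%R / r - RtoC c * y0 1%R / (r * r))%C.

Definition const_C1 (a b c d : R) (y : R -> C -> C) (lam0 K : C) : C :=
  let w := char_fun a b c d y in
  let y0 := eigenfun y lam0 in
  let A0 := frakA0 a b c d lam0 y0 in
  let Ahat := frakA1 a b c d lam0 y0 (yhat1 y lam0 K) in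
  (- ((Ahat * (C_derive_n 2 w lam0 / RtoC 2)
       + A0 * (C_derive_n 3 w lam0 / RtoC 6))
      / (A0 * (C_derive_n 2 w lam0 / RtoC 2))))%C.

Definition y1star (a b c d : R) (y : R -> C -> C) (lam0 K : C) : R -> C :=
  fun x => (assoc_fun y lam0 K x
            + const_C1 a b c d y lam0 K * eigenfun y lam0 x)%C.

(* Main.v *)
(** The functional [frakA1] is affine along [y0], so by the choice of [C1] the
    quantity [frakA1 y1star] collapses to [- frakA0 y0 * (K + w'''/(3 w''))].
    Since a solution whose Cauchy data vanish at 1 vanishes identically, the
    equation [w lam0 = 0] forces [frakA0 y0 <> 0].  In the case
    [c lam0 + d = 0] the affinity needs [ytilde1] to be differentiable in [x]
    at 1.  An energy (Gronwall) estimate shows that the difference quotients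
    [(y x lam - y x lam0) / (lam - lam0)] and their [x]-derivatives are Cauchy
    as [lam -> lam0], and that their second [x]-derivatives are bounded
    uniformly in [lam]; the second order Taylor bound at 1 then passes to the
    limit. *)

Require Import Defs.
From Stdlib Require Import Reals Lra.
From Coquelicot Require Import Coquelicot.
Open Scope R_scope.

(** * Complex moduli and differentiation relative to the unit interval *)

Lemma im_le_Cmod (z : C) : Rabs (snd z) <= Cmod z.
Proof. eapply Rle_trans; [apply Rmax_r | apply Rmax_Cmod]. Qed.

Lemma Cmod_le_re_im (z : C) : Cmod z <= Rabs (fst z) + Rabs (snd z).
Proof.
pattern z at 1; replace z with (RtoC (fst z) + Ci * RtoC (snd z))%C.
- eapply Rle_trans; [apply Cmod_triangle |].
  rewrite Cmod_mult, !Cmod_R, Cmod_Ci; lra.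
- destruct z as [u v]; apply injective_projections; simpl; ring.
Qed.

Lemma Cmod_sqr (z : C) : Cmod z ^ 2 = fst z ^ 2 + snd z ^ 2.
Proof. unfold Cmod; apply pow2_sqrt; nra. Qed.

(** Bridges the filter definition and explicit inequalities in [Cmod]; every later existence proof
    for [is_derive01] goes through this form or through lemmas obtained from it. *)
Lemma is_derive01_eps (f : R -> C) (x : R) (l : C) :
  I01 x ->
  is_derive01 f x l <->
  (forall eps, 0 < eps -> exists delta, 0 < delta /\
     forall t, I01 t -> Rabs (t - x) < delta ->
       Cmod (f t - f x - RtoC (t - x) * l) <= eps * Rabs (t - x)).
Proof.
intros Hx.
assert (Lx : @is_filter_lim R_UniformSpace (within I01 (locally x)) x).
{ intros P HP; unfold within; revert HP; apply filter_imp; auto. }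
split.
- intros [_ H] eps Heps.
  specialize (H x Lx (mkposreal _ Heps)).
  unfold within in H; simpl in H.
  destruct H as [delta Hd].
  exists delta; split; [apply cond_pos |]; intros t Ht Htd.
  specialize (Hd t Htd Ht); rewrite norm_C_R in Hd.
  change (Cmod (f t - f x - @scal R_AbsRing C_R_NormedModule (t - x)%R l)%C
          <= eps * Rabs (t - x)) in Hd.
  now rewrite scal_R_Cmult in Hd.
- intros H; split; [apply is_linear_scal_l |].
  intros x' Hx' eps.
  (* [filterdiff] quantifies over all limits of the restricted filter. That filter is proper, since
     every ball around [x] meets [0,1] in [x] itself, so its limit is unique. *)
  assert (E : x = x').
  { apply (@is_filter_lim_unique R_AbsRing R_NormedModule
      (within I01 (locally x))); auto.
    apply Build_ProperFilter'; [| typeclasses eauto].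
    intros [delta Hd].
    apply (Hd x (ball_center x delta) Hx). }
  subst x'.
  destruct (H eps (cond_pos eps)) as [delta [Hdel Hd]].
  exists (mkposreal _ Hdel); intros t Htd Ht.
  rewrite norm_C_R.
  change (Cmod (f t - f x - @scal R_AbsRing C_R_NormedModule (t - x)%R l)%C
          <= eps * Rabs (t - x)).
  rewrite scal_R_Cmult; apply Hd; auto.
Qed.

Lemma derive01_correct (f : R -> C) (x : R) :
  I01 x -> ex_derive01 f x -> is_derive01 f x (derive01 f x).
Proof. intros Hx [l H]; now rewrite (is_derive01_unique f x l Hx H). Qed.

Lemma is_derive01_lin (f g : R -> C) (x : R) (l m z w : C) :
  I01 x -> is_derive01 f x l -> is_derive01 g x m ->
  is_derive01 (fun t => z * f t + w * g t)%C x (z * l + w * m)%C.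
Proof.
intros Hx Hf Hg; apply is_derive01_eps; auto; intros eps Heps.
pose proof (Cmod_ge_0 z) as Hz; pose proof (Cmod_ge_0 w) as Hw.
set (N := 1 + Cmod z + Cmod w).
assert (HN : 0 < N) by (unfold N; lra).
assert (He : 0 < eps / N) by now apply Rdiv_lt_0_compat.
destruct (proj1 (is_derive01_eps f x l Hx) Hf _ He) as [d1 [Hd1 H1]].
destruct (proj1 (is_derive01_eps g x m Hx) Hg _ He) as [d2 [Hd2 H2]].
exists (Rmin d1 d2); split; [now apply Rmin_pos |]; intros t Ht Htd.
specialize (H1 t Ht (Rlt_le_trans _ _ _ Htd (Rmin_l _ _))).
specialize (H2 t Ht (Rlt_le_trans _ _ _ Htd (Rmin_r _ _))).
replace (z * f t + w * g t - (z * f x + w * g x)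
         - RtoC (t - x) * (z * l + w * m))%C
  with (z * (f t - f x - RtoC (t - x) * l)
        + w * (g t - g x - RtoC (t - x) * m))%C by ring.
eapply Rle_trans; [apply Cmod_triangle |]; rewrite !Cmod_mult.
replace (eps * Rabs (t - x)) with (N * (eps / N * Rabs (t - x)))
  by (field; lra).
assert (0 <= eps / N * Rabs (t - x)).
{ apply Rmult_le_pos; [lra | apply Rabs_pos]. }
apply (Rmult_le_compat_l _ _ _ Hz) in H1.
apply (Rmult_le_compat_l _ _ _ Hw) in H2.
unfold N at 1; lra.
Qed.

Lemma is_derive01_ext (f g : R -> C) (x : R) (l : C) :
  I01 x -> (forall t, I01 t -> f t = g t) ->
  is_derive01 f x l -> is_derive01 g x l.
Proof.
intros Hx E H; apply is_derive01_eps; auto; intros eps Heps.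
destruct (proj1 (is_derive01_eps f x l Hx) H eps Heps) as [delta [Hdel Hd]].
exists delta; split; auto; intros t Ht Htd.
rewrite <- (E t Ht), <- (E x Hx); auto.
Qed.

(** * Continuity and the mean value theorem on the closed interval *)

(** The 1-Lipschitz retraction of the line onto [0,1]. Composing with it turns one-sided continuity
    at 0 and 1 into ordinary continuity, as theorems about functions on the whole line require. *)
Definition clamp (x : R) : R := Rmax 0 (Rmin x 1).

Lemma clamp_I01 (x : R) : I01 (clamp x).
Proof. unfold I01, clamp, Rmax, Rmin; repeat destruct Rle_dec; lra. Qed.

Lemma clamp_id (x : R) : I01 x -> clamp x = x.
Proof. unfold I01, clamp, Rmax, Rmin; repeat destruct Rle_dec; lra. Qed.

Lemma clamp_lip (x t : R) : Rabs (clamp t - clamp x) <= Rabs (t - x).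
Proof.
unfold clamp, Rmax, Rmin, Rabs;
repeat destruct Rle_dec; repeat destruct Rcase_abs; lra.
Qed.

Lemma continuous_clamp {V : UniformSpace} (f : R -> V) (x : R) :
  continuous_on I01 f -> continuous (fun t => f (clamp t)) x.
Proof.
intros H P HP.
destruct (H (clamp x) (clamp_I01 x) P HP) as [delta Hd].
exists delta; intros t Ht; apply Hd; [| apply clamp_I01].
eapply Rle_lt_trans; [apply clamp_lip | exact Ht].
Qed.

(** Tolerance 1 in the derivative gives [Cmod (f t - f x) <= (1 + Cmod (f' x)) * Rabs (t - x)] near
    [x]. Real and imaginary parts are separated because the mean value theorem is a real
    statement. *)
Lemma is_derive01_continuous (f f' : R -> C) :
  (forall x, I01 x -> is_derive01 f x (f' x)) ->
  forall x, continuous (fun t => fst (f (clamp t))) x /\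
            continuous (fun t => snd (f (clamp t))) x.
Proof.
intros H x0.
assert (K : forall x, I01 x -> forall eps : posreal, exists delta : posreal,
   forall t, Rabs (t - x) < delta -> I01 t -> Cmod (f t - f x) < eps).
{ intros x Hx eps.
  destruct (proj1 (is_derive01_eps f x _ Hx) (H x Hx) 1 Rlt_0_1)
    as [delta [Hdel Hd]].
  set (M := 1 + Cmod (f' x)).
  assert (HM : 0 < M) by (unfold M; pose proof (Cmod_ge_0 (f' x)); lra).
  assert (Hm : 0 < Rmin delta (eps / M)).
  { apply Rmin_pos; auto; apply Rdiv_lt_0_compat; auto; apply cond_pos. }
  exists (mkposreal _ Hm); simpl; intros t Ht It.
  specialize (Hd t It (Rlt_le_trans _ _ _ Ht (Rmin_l _ _))).
  apply Rle_lt_trans with (M * Rabs (t - x)).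
  - replace (f t - f x)%C with
      ((f t - f x - RtoC (t - x) * f' x) + RtoC (t - x) * f' x)%C by ring.
    eapply Rle_trans; [apply Cmod_triangle |].
    rewrite Cmod_mult, Cmod_R; unfold M; lra.
  - replace (pos eps) with (M * (eps / M)) by (field; lra).
    apply Rmult_lt_compat_l; auto.
    exact (Rlt_le_trans _ _ _ Ht (Rmin_r _ _)). }
split; [apply (continuous_clamp (fun x => fst (f x))) |
        apply (continuous_clamp (fun x => snd (f x)))];
  intros x Hx P [eps HP]; destruct (K x Hx eps) as [delta Hd];
  exists delta; intros t Ht It; apply HP;
  eapply Rle_lt_trans; [| exact (Hd t Ht It) | | exact (Hd t Ht It)].
- exact (re_le_Cmod (f t - f x)).
- exact (im_le_Cmod (f t - f x)).
Qed.

(** A ball of radius at most [Rmin x (1 - x)] stays inside [0,1], so there the restriction of the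
    neighbourhoods has no effect. *)
Lemma is_derive01_interior (f : R -> C) (x : R) (l : C) :
  0 < x < 1 -> is_derive01 f x l ->
  is_derive (fun t => fst (f t)) x (fst l) /\
  is_derive (fun t => snd (f t)) x (snd l).
Proof.
intros Hx H.
assert (Ix : I01 x) by (unfold I01; lra).
assert (K : forall eps : posreal, exists delta : posreal,
  forall t, Rabs (t - x) < delta ->
    Cmod (f t - f x - RtoC (t - x) * l) <= eps * Rabs (t - x)).
{ intros eps.
  destruct (proj1 (is_derive01_eps f x l Ix) H eps (cond_pos eps))
    as [delta [Hdel Hd]].
  assert (Hm : 0 < Rmin delta (Rmin x (1 - x)))
    by (repeat apply Rmin_pos; lra).
  exists (mkposreal _ Hm); simpl; intros t Ht; apply Hd.
  - assert (Ht2 := Rlt_le_trans _ _ _ Ht (Rmin_r _ _)).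
    assert (Ht3 := Rlt_le_trans _ _ _ Ht2 (Rmin_l _ _)).
    assert (Ht4 := Rlt_le_trans _ _ _ Ht2 (Rmin_r _ _)).
    apply Rabs_def2 in Ht3; apply Rabs_def2 in Ht4; unfold I01; lra.
  - exact (Rlt_le_trans _ _ _ Ht (Rmin_l _ _)). }
split; (split; [apply is_linear_scal_l |]);
  intros x' Hx' eps; rewrite <- (is_filter_lim_locally_unique _ _ Hx');
  destruct (K eps) as [delta Hd]; exists delta; intros t Ht;
  (eapply Rle_trans; [| exact (Hd t Ht)]).
- eapply Rle_trans; [| apply re_le_Cmod]; right.
  unfold norm, minus, plus, opp, scal, mult; simpl; unfold mult, abs; simpl.
  unfold mult; simpl. f_equal; ring.
- eapply Rle_trans; [| apply im_le_Cmod]; right.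
  unfold norm, minus, plus, opp, scal, mult; simpl; unfold mult, abs; simpl.
  unfold mult; simpl. f_equal; ring.
Qed.

(** The classical theorem is applied to [g] composed with [clamp], which is continuous everywhere
    and agrees with [g] near each interior point. *)
Lemma MVT01 (g dg : R -> R) (s t : R) :
  (forall x, continuous (fun t => g (clamp t)) x) ->
  (forall x, 0 < x < 1 -> is_derive g x (dg x)) ->
  I01 s -> I01 t -> s < t ->
  exists x, s < x < t /\ g t - g s = dg x * (t - s).
Proof.
intros Hc Hd Hs Ht Hst; unfold I01 in Hs, Ht.
assert (D : forall x, s < x < t ->
  derivable_pt_lim (fun u => g (clamp u)) x (dg x)).
{ intros x Hx; apply is_derive_Reals.
  apply is_derive_ext_loc with (2 := Hd x ltac:(lra)).
  assert (Hp : 0 < Rmin (x - s) (t - x)) by (apply Rmin_pos; lra).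
  exists (mkposreal _ Hp); intros u Hu; f_equal; symmetry; apply clamp_id.
  change (Rabs (u - x) < Rmin (x - s) (t - x)) in Hu.
  pose proof (Rmin_l (x - s) (t - x)); pose proof (Rmin_r (x - s) (t - x)).
  apply Rabs_def2 in Hu; unfold I01; lra. }
destruct (MVT (fun u => g (clamp u)) id s t
  (fun x Hx => exist _ (dg x) (D x Hx))
  (fun x _ => derivable_pt_id x) Hst) as [x [Hx E]].
- intros x _; apply continuity_pt_filterlim.
  exact (Hc x).
- intros x _; apply derivable_continuous_pt, derivable_pt_id.
- exists x; split; auto.
  rewrite !clamp_id in E by (unfold I01; lra).
  rewrite derive_pt_id in E; simpl in E; unfold id in E; lra.
Qed.

(* The factor 2 comes from treating real and imaginary parts separately. *)
Lemma derive01_increment_le (f f' : R -> C) (x M : R) :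
  (forall t, I01 t -> is_derive01 f t (f' t)) -> I01 x ->
  (forall t, x < t < 1 -> Cmod (f' t) <= M) ->
  Cmod (f x - f 1) <= 2 * M * (1 - x).
Proof.
intros H Hx HM.
destruct (Req_dec x 1) as [-> | Hx1].
{ replace (f 1 - f 1)%C with (RtoC 0) by ring; rewrite Cmod_0; lra. }
assert (Hx' : x < 1) by (unfold I01 in Hx; lra).
pose proof (is_derive01_continuous f f' H) as Hc.
assert (I1 : I01 1) by (unfold I01; lra).
assert (D : forall t, 0 < t < 1 ->
  is_derive (fun t => fst (f t)) t (fst (f' t)) /\
  is_derive (fun t => snd (f t)) t (snd (f' t))).
{ intros t Ht; apply is_derive01_interior; auto; apply H; unfold I01; lra. }
destruct (MVT01 _ _ x 1 (fun t => proj1 (Hc t)) (fun t Ht => proj1 (D t Ht)) Hx I1 Hx')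
  as [s [Hs Es]].
destruct (MVT01 _ _ x 1 (fun t => proj2 (Hc t)) (fun t Ht => proj2 (D t Ht)) Hx I1 Hx')
  as [t [Ht Et]].
eapply Rle_trans; [apply Cmod_le_re_im |].
change (fst (f x - f 1)%C) with (fst (f x) - fst (f 1)).
change (snd (f x - f 1)%C) with (snd (f x) - snd (f 1)).
rewrite (Rabs_minus_sym (fst (f x))), (Rabs_minus_sym (snd (f x))), Es, Et.
rewrite !Rabs_mult, (Rabs_pos_eq (1 - x)) by lra.
pose proof (Rle_trans _ _ _ (re_le_Cmod _) (HM s Hs)) as A1; unfold Re in A1.
pose proof (Rle_trans _ _ _ (im_le_Cmod _) (HM t Ht)) as A2.
nra.
Qed.

(** * Energy and Gronwall estimates *)

Lemma ex_derive_clamp (g : R -> R) (x : R) :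
  (forall t, ex_derive g t) -> continuous (fun t => g (clamp t)) x.
Proof.
intros H; apply (continuous_clamp g); intros u _ P HP.
destruct (ex_derive_continuous g u (H u) P HP) as [delta Hd].
exists delta; intros t Ht _; exact (Hd t Ht).
Qed.

(** The function [E t * exp (- L * t) - G * t] has derivative at most [G * exp (- L * t) - G], hence
    at most 0. The mean value theorem compares its values at 0 and [x], and no integral is
    involved. *)
Lemma gronwall01 (E dE : R -> R) (L G : R) :
  (forall x, continuous (fun t => E (clamp t)) x) ->
  (forall x, 0 < x < 1 -> is_derive E x (dE x)) ->
  0 <= L -> 0 <= G -> 0 <= E 0 ->
  (forall x, 0 < x < 1 -> Rabs (dE x) <= L * E x + G) ->
  forall x, I01 x -> E x <= (E 0 + G) * exp L.
Proof.
intros Hc Hd HL HG HE Hb x Hx.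
assert (I0 : I01 0) by (unfold I01; lra).
assert (HexpL : 1 <= exp L) by (pose proof (exp_ineq1_le L); lra).
destruct (Req_dec x 0) as [-> | Hx0]; [nra |].
assert (Hx' : 0 < x) by (unfold I01 in Hx; lra).
destruct (MVT01 (fun t => E t * exp (- L * t) - G * t)
  (fun t => (dE t - L * E t) * exp (- L * t) - G) 0 x) as [t [Ht Et]]; auto.
- intros t.
  apply (@continuous_minus R_UniformSpace R_AbsRing R_NormedModule).
  + apply (@continuous_mult R_UniformSpace R_AbsRing); [apply Hc |].
    apply (ex_derive_clamp (fun t => exp (- L * t))); intros u; auto_derive; auto.
  + apply (ex_derive_clamp (fun t => G * t)); intros u; auto_derive; auto.
- intros t Ht; auto_derive.
  + repeat split; exists (dE t); exact (Hd t Ht).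
  + replace (Derive (fun u : R => E u) t) with (dE t);
      [ring | symmetry; exact (is_derive_unique _ _ _ (Hd t Ht))].
- rewrite Rmult_0_r, exp_0, Rmult_0_r in Et.
  assert (Ht' : 0 < t < 1) by (unfold I01 in Hx; lra).
  assert (Hbt := Rle_trans _ _ _ (Rle_abs _) (Hb t Ht')).
  assert (P1 := exp_pos (- L * t)).
  assert (P2 : exp (- L * t) <= 1).
  { rewrite <- exp_0; destruct (Req_dec (L * t) 0) as [h | h].
    - right; f_equal; lra.
    - left; apply exp_increasing; nra. }
  assert (H1 : E x * exp (- L * x) <= E 0 + G).
  { unfold I01 in Hx.
    assert ((dE t - L * E t) * exp (- L * t) <= G) by nra.
    nra. }
  assert (P3 := exp_pos (L * x)).
  assert (P4 : exp (L * x) <= exp L).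
  { destruct (Req_dec (L * x) L) as [-> | h]; [lra |].
    left; apply exp_increasing; unfold I01 in Hx; nra. }
  replace (E x) with ((E x * exp (- L * x)) * exp (L * x)).
  + apply Rle_trans with ((E 0 + G) * exp (L * x)); nra.
  + rewrite Rmult_assoc, <- exp_plus.
    replace (- L * x + L * x) with 0 by ring; rewrite exp_0; ring.
Qed.

Definition energy (f f1 : R -> C) (x : R) : R :=
  Cmod (f x) ^ 2 + Cmod (f1 x) ^ 2.

Lemma inner_le_Cmod (z w : C) :
  Rabs (fst z * fst w + snd z * snd w) <= Cmod z * Cmod w.
Proof.
rewrite <- (Cmod_conj w), <- Cmod_mult.
eapply Rle_trans; [| apply re_le_Cmod]; right; f_equal.
destruct z, w; simpl; ring.
Qed.

(** Cauchy-Schwarz bounds the derivative by [2 |f| |f1| + 2 |f1| |f2|]. The bound is on its absolute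
    value, so it serves both forward estimates from 0 and backward ones from 1. *)
Lemma energy_derivative (f f1 f2 : R -> C) (Q F : R) :
  (forall x, I01 x -> is_derive01 f x (f1 x)) ->
  (forall x, I01 x -> is_derive01 f1 x (f2 x)) ->
  (forall x, 0 < x < 1 -> Cmod (f2 x) <= Q * Cmod (f x) + F) ->
  0 <= Q ->
  (forall x, continuous (fun t => energy f f1 (clamp t)) x) /\
  exists de, forall x, 0 < x < 1 ->
    is_derive (energy f f1) x (de x) /\
    Rabs (de x) <= (2 + Q) * energy f f1 x + F ^ 2.
Proof.
intros Hf Hf1 Hf2 HQ.
assert (S : forall x, (fst (f x) ^ 2 + snd (f x) ^ 2)
             + (fst (f1 x) ^ 2 + snd (f1 x) ^ 2) = energy f f1 x).
{ intros x; unfold energy; now rewrite !Cmod_sqr. }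
split.
- intros x.
  destruct (is_derive01_continuous _ _ Hf x) as [A1 A2].
  destruct (is_derive01_continuous _ _ Hf1 x) as [B1 B2].
  eapply continuous_ext; [intros t; apply S |].
  assert (Sq : forall g : R -> R, continuous g x ->
     continuous (fun t => g t ^ 2) x).
  { intros g Hg; apply continuous_ext with (fun t => g t * g t).
    - intros t; simpl; ring.
    - now apply (@continuous_mult R_UniformSpace R_AbsRing). }
  apply (@continuous_plus R_UniformSpace R_AbsRing R_NormedModule);
    apply (@continuous_plus R_UniformSpace R_AbsRing R_NormedModule);
    now apply Sq.
- exists (fun x =>
    2 * (fst (f x) * fst (f1 x) + snd (f x) * snd (f1 x)) +
    2 * (fst (f1 x) * fst (f2 x) + snd (f1 x) * snd (f2 x))).
  intros x Hx; assert (Ix : I01 x) by (unfold I01; lra).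
  destruct (is_derive01_interior _ _ _ Hx (Hf x Ix)) as [A1 A2].
  destruct (is_derive01_interior _ _ _ Hx (Hf1 x Ix)) as [B1 B2].
  split.
  + eapply is_derive_ext; [exact S |].
    assert (Sq : forall (g : R -> R) dg, is_derive g x dg ->
      is_derive (fun t => g t ^ 2) x (2 * g x * dg)).
    { intros g dg D; evar_last; [exact (is_derive_pow g 2 x dg D) |].
      simpl; ring. }
    evar_last.
    * exact (is_derive_plus _ _ _ _ _
        (is_derive_plus _ _ _ _ _ (Sq _ _ A1) (Sq _ _ A2))
        (is_derive_plus _ _ _ _ _ (Sq _ _ B1) (Sq _ _ B2))).
    * unfold plus; simpl; ring.
  + specialize (Hf2 x Hx).
    pose proof (inner_le_Cmod (f x) (f1 x)).
    pose proof (inner_le_Cmod (f1 x) (f2 x)).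
    pose proof (Cmod_ge_0 (f x)); pose proof (Cmod_ge_0 (f1 x)).
    eapply Rle_trans; [apply Rabs_triang |].
    rewrite !Rabs_mult, (Rabs_pos_eq 2) by lra.
    unfold energy.
    set (u := Cmod (f x)) in *; set (v := Cmod (f1 x)) in *.
    (* The products [2uv], [2Quv] and [2vF] are absorbed by [u^2 + v^2], [Q(u^2 + v^2)] and
       [v^2 + F^2]; the squares below are supplied for this. *)
    assert (v * Cmod (f2 x) <= v * (Q * u + F))
      by now apply Rmult_le_compat_l.
    assert (0 <= Q * (u - v) ^ 2) by (apply Rmult_le_pos; auto; apply pow2_ge_0).
    pose proof (pow2_ge_0 (u - v)); pose proof (pow2_ge_0 (v - F)).
    nra.
Qed.

(** Gronwall bounds the energy by [2 F^2 exp (2 + Q)]. Taking roots leaves a bound linear in [F],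
    which is what makes small sources yield proportionally small solutions. *)
Lemma ode_bound (f f1 f2 : R -> C) (Q F : R) :
  (forall x, I01 x -> is_derive01 f x (f1 x)) ->
  (forall x, I01 x -> is_derive01 f1 x (f2 x)) ->
  (forall x, 0 < x < 1 -> Cmod (f2 x) <= Q * Cmod (f x) + F) ->
  0 <= Q -> 0 <= F -> energy f f1 0 <= F ^ 2 ->
  forall x, I01 x -> Cmod (f x) <= 2 * exp (2 + Q) * F /\
                     Cmod (f1 x) <= 2 * exp (2 + Q) * F.
Proof.
intros Hf Hf1 Hf2 HQ HF H0 x Hx.
destruct (energy_derivative f f1 f2 Q F Hf Hf1 Hf2 HQ) as [Hc [de Hd]].
assert (G := gronwall01 (energy f f1) de (2 + Q) (F ^ 2) Hc
  (fun t Ht => proj1 (Hd t Ht)) ltac:(lra) (pow2_ge_0 F)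
  ltac:(unfold energy; nra) (fun t Ht => proj2 (Hd t Ht)) x Hx).
unfold energy in G at 1.
pose proof (exp_ineq1_le (2 + Q)); set (e := exp (2 + Q)) in *.
assert (0 <= e * F) by nra.
pose proof (pow2_ge_0 (Cmod (f x))); pose proof (pow2_ge_0 (Cmod (f1 x))).
pose proof (pow2_ge_0 F).
assert ((energy f f1 0 + F ^ 2) * e <= 2 * F ^ 2 * e) by nra.
(* Since [e >= 1], the energy is also at most [4 F^2 e^2], the square of the claimed bound. *)
assert (F ^ 2 * e <= F ^ 2 * e ^ 2) by (apply Rmult_le_compat_l; nra).
split; (apply Rsqr_incr_0_var; [rewrite !Rsqr_pow2; nra | lra]).
Qed.

(** With [L = 2 + Q] the energy times [exp (L * t)] has nonnegative derivative. Its value at 1 is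
    zero, so the energy at 0 is at most zero. *)
Lemma ode_backward_unique (f f1 f2 : R -> C) (Q : R) :
  (forall x, I01 x -> is_derive01 f x (f1 x)) ->
  (forall x, I01 x -> is_derive01 f1 x (f2 x)) ->
  (forall x, 0 < x < 1 -> Cmod (f2 x) <= Q * Cmod (f x)) ->
  0 <= Q -> f 1 = RtoC 0 -> f1 1 = RtoC 0 ->
  f 0 = RtoC 0 /\ f1 0 = RtoC 0.
Proof.
intros Hf Hf1 Hf2 HQ E1 E2.
destruct (energy_derivative f f1 f2 Q 0 Hf Hf1) as [Hc [de Hd]]; auto.
{ intros x Hx; rewrite Rplus_0_r; auto. }
set (L := 2 + Q) in *.
destruct (MVT01 (fun t => energy f f1 t * exp (L * t))
  (fun t => (de t + L * energy f f1 t) * exp (L * t)) 0 1) as [t [Ht Et]];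
  try (unfold I01; lra).
- intros t.
  apply (@continuous_mult R_UniformSpace R_AbsRing); [apply Hc |].
  apply (ex_derive_clamp (fun t => exp (L * t))); intros u; auto_derive; auto.
- intros t Ht; destruct (Hd t Ht) as [D _]; auto_derive.
  + repeat split; exists (de t); exact D.
  + replace (Derive (fun u : R => energy f f1 u) t) with (de t);
      [ring | symmetry; exact (is_derive_unique _ _ _ D)].
- destruct (Hd t Ht) as [_ B].
  unfold energy in Et at 1 2.
  rewrite E1, E2, Cmod_0, Rmult_0_r, exp_0 in Et.
  assert (0 <= de t + L * energy f f1 t).
  { pose proof (Rabs_maj2 (de t)); lra. }
  pose proof (exp_pos (L * t)).
  pose proof (pow2_ge_0 (Cmod (f 0))); pose proof (pow2_ge_0 (Cmod (f1 0))).
  assert (0 <= (de t + L * energy f f1 t) * exp (L * t)) by nra.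
  split; apply Cmod_eq_0; nra.
Qed.

(** * Cauchy criteria for real and complex limits *)

(** [Lim] is a total operator. Completeness first produces a finite limit, and uniqueness then
    identifies it with the value of [Lim]. *)
Lemma Lim_cauchy (f : R -> R) (x : R) :
  (forall eps, 0 < eps -> exists delta, 0 < delta /\ forall s t,
     0 < Rabs (s - x) < delta -> 0 < Rabs (t - x) < delta ->
     Rabs (f s - f t) <= eps) ->
  forall eps, 0 < eps -> exists delta, 0 < delta /\ forall s,
     0 < Rabs (s - x) < delta -> Rabs (f s - Lim f x) <= eps.
Proof.
intros H.
destruct (proj1 (@filterlim_locally_cauchy R R_CompleteSpace
  (Rbar_locally' x) _ f)) as [l Hl].
{ intros eps.
  destruct (H (eps / 2) ltac:(pose proof (cond_pos eps); lra))
    as [delta [Hdel Hd]].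
  exists (fun s => 0 < Rabs (s - x) < delta); split.
  - exists (mkposreal _ Hdel); intros s Hs Hsx; split; [| exact Hs].
    apply Rabs_pos_lt; lra.
  - intros s t Hs Ht; pose proof (cond_pos eps).
    eapply Rle_lt_trans; [exact (Hd t s Ht Hs) | lra]. }
assert (E : Lim f x = l) by (apply is_lim_unique; exact Hl).
rewrite E; intros eps Heps.
destruct (Hl (fun z => Rabs (z - l) < eps)) as [delta Hd].
{ exists (mkposreal _ Heps); intros z Hz; exact Hz. }
exists delta; split; [apply cond_pos |]; intros s [Hs1 Hs2].
left; apply Hd; [exact Hs2 |].
intros ->; rewrite Rminus_diag, Rabs_R0 in Hs1; lra.
Qed.

(* Coquelicot's [C_lim] only looks along the horizontal line through [z]. *)
Lemma C_lim_cauchy (f : C -> C) (z : C) :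
  (forall eps, 0 < eps -> exists delta, 0 < delta /\ forall s t,
     0 < Rabs (s - fst z) < delta -> 0 < Rabs (t - fst z) < delta ->
     Cmod (f (s, snd z) - f (t, snd z)) <= eps) ->
  forall eps, 0 < eps -> exists delta, 0 < delta /\ forall s,
     0 < Rabs (s - fst z) < delta -> Cmod (f (s, snd z) - C_lim f z) <= eps.
Proof.
intros H eps Heps.
destruct (Lim_cauchy (fun s => fst (f (s, snd z))) (fst z)) with (eps / 2)
  as [d1 [Hd1 H1]]; try lra.
{ intros e He; destruct (H e He) as [delta [Hdel Hd]].
  exists delta; split; auto; intros s t Hs Ht.
  eapply Rle_trans; [| exact (Hd s t Hs Ht)].
  exact (re_le_Cmod (f (s, snd z) - f (t, snd z))). }
destruct (Lim_cauchy (fun s => snd (f (s, snd z))) (fst z)) with (eps / 2)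
  as [d2 [Hd2 H2]]; try lra.
{ intros e He; destruct (H e He) as [delta [Hdel Hd]].
  exists delta; split; auto; intros s t Hs Ht.
  eapply Rle_trans; [| exact (Hd s t Hs Ht)].
  exact (im_le_Cmod (f (s, snd z) - f (t, snd z))). }
exists (Rmin d1 d2); split; [now apply Rmin_pos |]; intros s [Hs Hsd].
specialize (H1 s (conj Hs (Rlt_le_trans _ _ _ Hsd (Rmin_l _ _)))).
specialize (H2 s (conj Hs (Rlt_le_trans _ _ _ Hsd (Rmin_r _ _)))).
eapply Rle_trans; [apply Cmod_le_re_im |].
replace eps with (eps / 2 + eps / 2) by field.
now apply Rplus_le_compat.
Qed.

(** * The inhomogeneous Sturm-Liouville equation and its a priori bounds *)

(* [f] solves the inhomogeneous equation [- f'' + q f = lam f + h]. *)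
Definition SL_sol (q : R -> R) (lam : C) (h f f1 : R -> C) : Prop :=
  (forall x, I01 x -> is_derive01 f x (f1 x)) /\
  exists f2, (forall x, I01 x -> is_derive01 f1 x (f2 x)) /\
    forall x, 0 < x < 1 -> f2 x = ((RtoC (q x) - lam) * f x - h x)%C.

Lemma solves_SL_sol (q : R -> R) (lam : C) (f : R -> C) :
  solves_SL q lam f -> SL_sol q lam (fun _ => RtoC 0) f (derive01 f).
Proof.
intros [H1 [H2 H3]]; split; [intros; apply derive01_correct; auto |].
exists (derive01 (derive01 f)); split.
- intros; apply derive01_correct; auto.
- intros x Hx; specialize (H3 x Hx).
  replace (derive01 (derive01 f) x) with
    (RtoC (q x) * f x
     - (- derive01 (derive01 f) x + RtoC (q x) * f x))%C by ring.
  rewrite H3; ring.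
Qed.

(** The change of spectral parameter is moved into the source, so that solutions for different
    parameters can be subtracted. *)
Lemma SL_sol_shift (q : R -> R) (lam mu : C) (h f f1 : R -> C) :
  SL_sol q lam h f f1 ->
  SL_sol q mu (fun x => h x + (lam - mu) * f x)%C f f1.
Proof.
intros [H1 [f2 [H2 H3]]]; split; auto; exists f2; split; auto.
intros x Hx; rewrite H3 by auto; ring.
Qed.

Lemma SL_sol_lin (q : R -> R) (lam z w : C) (h f f1 k g g1 : R -> C) :
  SL_sol q lam h f f1 -> SL_sol q lam k g g1 ->
  SL_sol q lam (fun x => z * h x + w * k x)%C
    (fun x => z * f x + w * g x)%C (fun x => z * f1 x + w * g1 x)%C.
Proof.
intros [H1 [f2 [H2 H3]]] [K1 [g2 [K2 K3]]]; split.
- intros x Hx; apply is_derive01_lin; auto.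
- exists (fun x => z * f2 x + w * g2 x)%C; split.
  + intros x Hx; apply is_derive01_lin; auto.
  + intros x Hx; rewrite H3, K3 by auto; ring.
Qed.

Lemma SL_sol_bound (q : R -> R) (lam : C) (h f f1 : R -> C) (Q F : R) :
  SL_sol q lam h f f1 ->
  (forall x, 0 < x < 1 -> Cmod (RtoC (q x) - lam) <= Q) ->
  (forall x, 0 < x < 1 -> Cmod (h x) <= F) ->
  0 <= Q -> 0 <= F -> Cmod (f 0) ^ 2 + Cmod (f1 0) ^ 2 <= F ^ 2 ->
  forall x, I01 x -> Cmod (f x) <= 2 * exp (2 + Q) * F /\
                     Cmod (f1 x) <= 2 * exp (2 + Q) * F.
Proof.
intros [H1 [f2 [H2 H3]]] Hq Hh HQ HF H0 x Hx.
apply (ode_bound f f1 f2 Q F); auto.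
intros t Ht; rewrite H3 by auto.
unfold Cminus at 1.
eapply Rle_trans; [apply Cmod_triangle |].
rewrite Cmod_mult, Cmod_opp.
apply Rplus_le_compat; auto.
apply Rmult_le_compat_r; auto; apply Cmod_ge_0.
Qed.

(** The equation bounds the second derivative by [Q * B + F], and two increment estimates, each
    costing a factor 2, give the constant 4. The bound depends on [f] and [h] only through [B] and
    [F], so it survives a limit. *)
Lemma SL_sol_taylor (q : R -> R) (lam : C) (h f f1 : R -> C) (Q F B x : R) :
  SL_sol q lam h f f1 ->
  (forall x, 0 < x < 1 -> Cmod (RtoC (q x) - lam) <= Q) ->
  (forall x, 0 < x < 1 -> Cmod (h x) <= F) ->
  (forall x, 0 < x < 1 -> Cmod (f x) <= B) ->
  I01 x ->
  Cmod (f x - f 1 - RtoC (x - 1) * f1 1) <= 4 * (Q * B + F) * (1 - x) ^ 2.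
Proof.
intros [H1 [f2 [H2 H3]]] Hq Hh Hf Hx.
set (M := Q * B + F).
assert (HM : forall t, 0 < t < 1 -> Cmod (f2 t) <= M).
{ intros t Ht; rewrite H3 by auto; unfold Cminus at 1.
  eapply Rle_trans; [apply Cmod_triangle |].
  rewrite Cmod_mult, Cmod_opp; unfold M.
  apply Rplus_le_compat; auto.
  apply Rmult_le_compat; auto; apply Cmod_ge_0. }
assert (K : forall t, I01 t -> Cmod (f1 t - f1 1) <= 2 * M * (1 - t)).
{ intros t Ht; apply (derive01_increment_le f1 f2); auto.
  intros u Hu; apply HM; unfold I01 in Ht; lra. }
assert (M0 : 0 <= M) by exact (Rle_trans _ _ _ (Cmod_ge_0 _) (HM (1/2) ltac:(lra))).
replace (f x - f 1 - RtoC (x - 1) * f1 1)%C with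
  ((RtoC 1 * f x + - f1 1 * RtoC x) - (RtoC 1 * f 1 + - f1 1 * RtoC 1))%C
  by (rewrite RtoC_minus; ring).
replace (4 * M * (1 - x) ^ 2) with (2 * (2 * M * (1 - x)) * (1 - x)) by ring.
(* The tangent slope at 1 is subtracted first: the derivative of the remaining function is
   [f1 t - f1 1], already of order [1 - t] by [K]. *)
apply (derive01_increment_le (fun t => RtoC 1 * f t + - f1 1 * RtoC t)%C
  (fun t => RtoC 1 * f1 t + - f1 1 * RtoC 1)%C); auto.
- intros t Ht; apply is_derive01_lin; auto.
  apply is_derive01_eps; auto; intros eps Heps; exists 1; split; [lra |].
  intros u _ _; rewrite RtoC_minus.
  replace (RtoC u - RtoC t - (RtoC u - RtoC t) * RtoC 1)%C with (RtoC 0) by ring.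
  rewrite Cmod_0; apply Rmult_le_pos; [lra | apply Rabs_pos].
- intros t Ht.
  replace (RtoC 1 * f1 t + - f1 1 * RtoC 1)%C with (f1 t - f1 1)%C by ring.
  eapply Rle_trans; [apply K; unfold I01 in *; lra |].
  apply Rmult_le_compat_l; lra.
Qed.

Lemma continuous_on_bounded (q : R -> R) :
  continuous_on I01 q -> exists M, 0 <= M /\ forall x, I01 x -> Rabs (q x) <= M.
Proof.
intros Hq.
destruct (bounded_continuity (fun t => q (clamp t)) 0 1) as [M HM].
{ intros x _; exact (continuous_clamp q x Hq). }
assert (K : forall x, I01 x -> Rabs (q x) <= M).
{ intros x Hx; left; rewrite <- (clamp_id x Hx) at 1; exact (HM x Hx). }
exists M; split; auto.
apply Rle_trans with (Rabs (q 0)); [apply Rabs_pos |].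
apply K; unfold I01; lra.
Qed.

Lemma SL_sol_ext (q : R -> R) (lam : C) (h h' f f' f1 f1' : R -> C) :
  (forall x, h x = h' x) -> (forall x, f x = f' x) ->
  (forall x, f1 x = f1' x) ->
  SL_sol q lam h f f1 -> SL_sol q lam h' f' f1'.
Proof.
intros Eh Ef E1 [H1 [f2 [H2 H3]]]; split.
- intros x Hx; rewrite <- E1; apply is_derive01_ext with f; auto.
- exists f2; split.
  + intros x Hx; apply is_derive01_ext with f1; auto.
  + intros x Hx; rewrite <- Ef, <- Eh; auto.
Qed.

(** * Differentiability in x of the derivative with respect to the spectral parameter *)

(** A closed inequality passes to the limit; the Cauchy hypotheses ensure that each [C_lim] is a
    genuine limit along the horizontal line. *)
Lemma Cmod_lim_le (f g h : C -> C) (z k : C) (M : R) :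
  (forall u : C -> C, u = f \/ u = g \/ u = h ->
    forall eps, 0 < eps -> exists delta, 0 < delta /\ forall s t,
     0 < Rabs (s - fst z) < delta -> 0 < Rabs (t - fst z) < delta ->
     Cmod (u (s, snd z) - u (t, snd z)) <= eps) ->
  (exists delta, 0 < delta /\ forall s, 0 < Rabs (s - fst z) < delta ->
    Cmod (f (s, snd z) - g (s, snd z) - k * h (s, snd z)) <= M) ->
  Cmod (C_lim f z - C_lim g z - k * C_lim h z) <= M.
Proof.
intros Hc [d0 [Hd0 H0]].
apply le_epsilon; intros eps Heps.
pose proof (Cmod_ge_0 k) as Hk.
(* The three approximation errors enter with weights 1, 1 and [Cmod k]. *)
set (e := eps / (2 + Cmod k)).
assert (He : 0 < e) by (apply Rdiv_lt_0_compat; lra).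
destruct (C_lim_cauchy f z (Hc f ltac:(tauto)) e He) as [d1 [Hd1 H1]].
destruct (C_lim_cauchy g z (Hc g ltac:(tauto)) e He) as [d2 [Hd2 H2]].
destruct (C_lim_cauchy h z (Hc h ltac:(tauto)) e He) as [d3 [Hd3 H3]].
set (m := Rmin (Rmin d0 d1) (Rmin d2 d3)).
assert (Hm : 0 < m) by (unfold m; repeat apply Rmin_pos; auto).
assert (Hm' : m <= d0 /\ m <= d1 /\ m <= d2 /\ m <= d3).
{ unfold m; pose proof (Rmin_l (Rmin d0 d1) (Rmin d2 d3));
  pose proof (Rmin_r (Rmin d0 d1) (Rmin d2 d3));
  pose proof (Rmin_l d0 d1); pose proof (Rmin_r d0 d1);
  pose proof (Rmin_l d2 d3); pose proof (Rmin_r d2 d3); lra. }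
set (s := fst z + m / 2).
assert (Hs : Rabs (s - fst z) = m / 2).
{ unfold s; replace (fst z + m / 2 - fst z) with (m / 2) by ring.
  apply Rabs_pos_eq; lra. }
specialize (H0 s ltac:(lra)); specialize (H1 s ltac:(lra)).
specialize (H2 s ltac:(lra)); specialize (H3 s ltac:(lra)).
set (w := (s, snd z)) in *.
replace (C_lim f z - C_lim g z - k * C_lim h z)%C with
  ((f w - g w - k * h w) + (- (f w - C_lim f z) + ((g w - C_lim g z)
    + k * (h w - C_lim h z))))%C by ring.
eapply Rle_trans; [apply Cmod_triangle |].
apply Rplus_le_compat; auto.
eapply Rle_trans; [apply Cmod_triangle |]; rewrite Cmod_opp.
eapply Rle_trans; [apply Rplus_le_compat_l, Cmod_triangle |].
rewrite Cmod_mult.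
apply (Rmult_le_compat_l _ _ _ Hk) in H3.
replace eps with (e + (e + Cmod k * e)) by (unfold e; field; lra).
lra.
Qed.

Lemma ytilde1_ex_derive01 (q : R -> R) (beta : R) (y : R -> C -> C) (lam0 : C) :
  continuous_on I01 q -> is_initial_solution q beta y ->
  ex_derive01 (ytilde1 y lam0) 1.
Proof.
intros Hq Hy.
destruct (continuous_on_bounded q Hq) as [Q0 [HQ0 Hq0]].
(* Bounds [q - lam] uniformly for [lam] in the closed unit disc around [lam0]. *)
set (Q := Q0 + (Cmod lam0 + 1)).
pose proof (Cmod_ge_0 lam0) as Hl0.
assert (HQ : 0 <= Q) by (unfold Q; lra).
assert (Hlam : forall lam, Cmod (lam - lam0) <= 1 ->
  forall x, 0 < x < 1 -> Cmod (RtoC (q x) - lam) <= Q).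
{ intros lam Hlam x Hx.
  replace (RtoC (q x) - lam)%C
    with (RtoC (q x) + (- lam0 + - (lam - lam0)))%C by ring.
  eapply Rle_trans; [apply Cmod_triangle |].
  rewrite Cmod_R; apply Rplus_le_compat.
  - apply Hq0; unfold I01; lra.
  - eapply Rle_trans; [apply Cmod_triangle |]; rewrite !Cmod_opp; lra. }
assert (Hlam0 : forall x, 0 < x < 1 -> Cmod (RtoC (q x) - lam0) <= Q).
{ apply Hlam; replace (lam0 - lam0)%C with (RtoC 0) by ring.
  rewrite Cmod_0; lra. }
set (y' := fun lam => derive01 (fun x => y x lam)).
assert (S : forall lam, SL_sol q lam (fun _ => RtoC 0) (fun x => y x lam) (y' lam)).
{ intros lam; apply solves_SL_sol, Hy. }
assert (I0 : forall lam, y 0 lam = RtoC (sin beta) /\ y' lam 0 = RtoC (cos beta)).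
{ intros lam; exact (proj2 (Hy lam)). }
set (B := 2 * exp (2 + Q)).
assert (HB : 0 <= B) by (unfold B; pose proof (exp_pos (2 + Q)); lra).
(* The initial data [sin beta], [cos beta] have energy 1, so [F = 1] is admissible. *)
assert (H1 : forall x, I01 x -> Cmod (y x lam0) <= B).
{ intros x Hx; rewrite <- (Rmult_1_r B).
  apply (SL_sol_bound q lam0 (fun _ => RtoC 0) (fun x => y x lam0) (y' lam0) Q 1);
    auto; try lra.
  - intros; rewrite Cmod_0; lra.
  - destruct (I0 lam0) as [-> ->]; rewrite !Cmod_R, !pow2_abs.
    pose proof (sin2_cos2 beta); unfold Rsqr in *; nra. }
(* The difference has zero initial data and solves the equation for [lam] with source
   [(lam - lam0) * y x lam0]; the linear bound makes it Lipschitz in the parameter. *)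
assert (H2 : forall lam, Cmod (lam - lam0) <= 1 -> forall x, I01 x ->
  Cmod (y x lam - y x lam0) <= B * (Cmod (lam - lam0) * B)).
{ intros lam Hl x Hx.
  pose proof (Cmod_ge_0 (lam - lam0)).
  apply (SL_sol_bound q lam (fun x => (lam - lam0) * y x lam0)%C
    (fun x => y x lam - y x lam0)%C (fun x => y' lam x - y' lam0 x)%C Q); auto.
  - eapply SL_sol_ext; [| | |
      exact (SL_sol_lin _ _ (RtoC 1) (- RtoC 1) _ _ _ _ _ _ (S lam)
              (SL_sol_shift _ _ lam _ _ _ (S lam0)))];
      intros t; simpl; ring.
  - intros t Ht; rewrite Cmod_mult; apply Rmult_le_compat_l; auto.
    apply H1; unfold I01; lra.
  - now apply Rmult_le_pos.
  - destruct (I0 lam) as [-> ->]; destruct (I0 lam0) as [-> ->].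
    replace (RtoC (sin beta) - RtoC (sin beta))%C with (RtoC 0) by ring.
    replace (RtoC (cos beta) - RtoC (cos beta))%C with (RtoC 0) by ring.
    rewrite Cmod_0; pose proof (pow2_ge_0 (Cmod (lam - lam0) * B)); lra. }
(* Difference quotients in the parameter and their x-derivatives. By [Su], [u lam] solves the
   equation at the fixed parameter [lam0] with source [y x lam]. *)
set (u := fun lam x => ((y x lam - y x lam0) / (lam - lam0))%C).
set (u' := fun lam x => ((y' lam x - y' lam0 x) / (lam - lam0))%C).
assert (Su : forall lam, lam <> lam0 ->
  SL_sol q lam0 (fun x => y x lam) (u lam) (u' lam)).
{ intros lam Hne.
  assert (Hd : (lam - lam0)%C <> RtoC 0) by now apply Cminus_eq_contra.
  eapply SL_sol_ext; [| | |
    exact (SL_sol_lin _ _ (/ (lam - lam0)) (- / (lam - lam0)) _ _ _ _ _ _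
            (SL_sol_shift _ _ lam0 _ _ _ (S lam)) (S lam0))];
    intros t; unfold u, u'; simpl; field; auto. }
assert (Z : forall lam, u lam 0 = RtoC 0 /\ u' lam 0 = RtoC 0).
{ intros lam; unfold u, u'.
  destruct (I0 lam) as [-> ->]; destruct (I0 lam0) as [-> ->].
  unfold Cdiv; split; ring. }
assert (H3 : forall lam, lam <> lam0 -> Cmod (lam - lam0) <= 1 ->
  forall x, I01 x -> Cmod (y x lam) <= B + B * B).
{ intros lam Hne Hl x Hx.
  replace (y x lam) with (y x lam0 + (y x lam - y x lam0))%C by ring.
  eapply Rle_trans; [apply Cmod_triangle |].
  apply Rplus_le_compat; auto.
  eapply Rle_trans; [apply H2; auto |].
  apply Rmult_le_compat_l; auto.
  rewrite <- (Rmult_1_l B) at 2; now apply Rmult_le_compat_r. }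
assert (HBB : 0 <= B + B * B) by nra.
assert (H4 : forall lam, lam <> lam0 -> Cmod (lam - lam0) <= 1 ->
  forall x, I01 x -> Cmod (u lam x) <= B * (B + B * B)).
{ intros lam Hne Hl x Hx.
  apply (SL_sol_bound q lam0 (fun x => y x lam) (u lam) (u' lam) Q); auto.
  - intros t Ht; apply H3; auto; unfold I01; lra.
  - destruct (Z lam) as [-> ->]; rewrite Cmod_0; nra. }
(* The difference of two quotients has zero data and source [y x lam - y x mu], which [H2] makes
   small. This is the Cauchy property, for values and x-derivatives at once. *)
assert (H5 : forall lam mu, lam <> lam0 -> mu <> lam0 ->
  Cmod (lam - lam0) <= 1 -> Cmod (mu - lam0) <= 1 -> forall x, I01 x ->
  Cmod (u lam x - u mu x) <= B * (B * B * (Cmod (lam - lam0) + Cmod (mu - lam0))) /\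
  Cmod (u' lam x - u' mu x) <= B * (B * B * (Cmod (lam - lam0) + Cmod (mu - lam0)))).
{ intros lam mu Hn1 Hn2 Hl1 Hl2 x Hx.
  pose proof (Cmod_ge_0 (lam - lam0)); pose proof (Cmod_ge_0 (mu - lam0)).
  apply (SL_sol_bound q lam0 (fun x => y x lam - y x mu)%C
    (fun x => u lam x - u mu x)%C (fun x => u' lam x - u' mu x)%C Q); auto.
  - eapply SL_sol_ext; [| | |
      exact (SL_sol_lin _ _ (RtoC 1) (- RtoC 1) _ _ _ _ _ _ (Su lam Hn1)
              (Su mu Hn2))]; intros t; simpl; ring.
  - intros t Ht; assert (It : I01 t) by (unfold I01; lra).
    replace (y t lam - y t mu)%C
      with ((y t lam - y t lam0) + - (y t mu - y t lam0))%C by ring.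
    eapply Rle_trans; [apply Cmod_triangle |]; rewrite Cmod_opp.
    pose proof (H2 lam Hl1 t It); pose proof (H2 mu Hl2 t It); lra.
  - apply Rmult_le_pos; nra.
  - destruct (Z lam) as [-> ->]; destruct (Z mu) as [-> ->].
    replace (RtoC 0 - RtoC 0)%C with (RtoC 0) by ring.
    rewrite Cmod_0.
    pose proof (pow2_ge_0 (B * B * (Cmod (lam - lam0) + Cmod (mu - lam0)))).
    lra. }
assert (Hs : forall s, ((s, snd lam0) - lam0)%C = RtoC (s - fst lam0)).
{ intros s; destruct lam0; unfold RtoC; apply injective_projections;
    simpl; ring. }
assert (Hne : forall s, 0 < Rabs (s - fst lam0) -> (s, snd lam0) <> lam0).
{ intros s Hs' E; rewrite <- E in Hs' at 1; simpl in Hs'.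
  rewrite Rminus_diag, Rabs_R0 in Hs'; lra. }
assert (Cau : forall w : C -> C,
  (w = (fun lam => u' lam 1) \/ exists x, I01 x /\ w = fun lam => u lam x) ->
  forall eps, 0 < eps -> exists delta, 0 < delta /\ forall s t,
     0 < Rabs (s - fst lam0) < delta -> 0 < Rabs (t - fst lam0) < delta ->
     Cmod (w (s, snd lam0) - w (t, snd lam0)) <= eps).
{ intros w Hw eps Heps.
  set (N := 1 + 2 * (B * (B * B))).
  assert (HN : 0 < N).
  { assert (0 <= B * (B * B)) by (apply Rmult_le_pos; nra). unfold N; lra. }
  exists (Rmin 1 (eps / N)); split.
  { apply Rmin_pos; [lra | now apply Rdiv_lt_0_compat]. }
  intros s t [Hs1 Hs2] [Ht1 Ht2].
  pose proof (Rmin_l 1 (eps / N)); pose proof (Rmin_r 1 (eps / N)).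
  assert (H6 : forall x, I01 x ->
    Cmod (u (s, snd lam0) x - u (t, snd lam0) x) <= eps /\
    Cmod (u' (s, snd lam0) x - u' (t, snd lam0) x) <= eps).
  { intros x Hx.
    assert (B * (B * B * (Cmod ((s, snd lam0) - lam0) + Cmod ((t, snd lam0) - lam0)))
            <= eps).
    { rewrite !Hs, !Cmod_R.
      replace eps with (N * (eps / N)) by (field; lra).
      assert (0 <= B * (B * B)) by (apply Rmult_le_pos; nra).
      assert (0 <= eps / N) by lra.
      apply Rle_trans with (2 * (B * (B * B)) * (eps / N)).
      - rewrite <- Rmult_assoc.
        replace (2 * (B * (B * B)) * (eps / N))
          with (B * (B * B) * (eps / N + eps / N)) by ring.
        apply Rmult_le_compat_l; lra.
      - apply Rmult_le_compat_r; auto; unfold N; lra. }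
    destruct (H5 (s, snd lam0) (t, snd lam0)) with x as [A1 A2]; auto;
      try (rewrite Hs, Cmod_R; lra).
    split; lra. }
  destruct Hw as [-> | [x [Hx ->]]].
  - apply H6; unfold I01; lra.
  - now apply H6. }
set (M := 4 * (Q * (B * (B + B * B)) + (B + B * B))).
assert (HM : 0 <= M).
{ unfold M; assert (0 <= B * (B + B * B)) by now apply Rmult_le_pos.
  assert (0 <= Q * (B * (B + B * B))) by now apply Rmult_le_pos. lra. }
assert (I1 : I01 1) by (unfold I01; lra).
(* The candidate is the limit of the x-derivatives at 1, which amounts to exchanging the two
   differentiations. *)
exists (C_lim (fun lam => u' lam 1) lam0).
apply is_derive01_eps; auto; intros eps Heps.
(* With this radius the quadratic bound [M * (1 - x) ^ 2] is at most [eps * (1 - x)]; the 1 keeps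
   the denominator positive. *)
exists (eps / (1 + M)); split; [apply Rdiv_lt_0_compat; lra |].
intros x Hx Hxd.
apply Rle_trans with (M * (1 - x) ^ 2).
(* [ytilde1 y lam0 x] unfolds to the [C_lim] of [u lam x], so the Taylor bound for the quotients
   transfers to it. *)
- apply (Cmod_lim_le (fun lam => u lam x) (fun lam => u lam 1)
    (fun lam => u' lam 1)).
  + intros w Hw; apply Cau; destruct Hw as [Hw | [Hw | Hw]]; eauto.
  + exists 1; split; [lra |]; intros s [Hs1 Hs2].
    apply (SL_sol_taylor q lam0 (fun x => y x (s, snd lam0)) _ _ Q); auto.
    * intros t Ht; apply H3; auto; [rewrite Hs, Cmod_R; lra | unfold I01; lra].
    * intros t Ht; apply H4; auto; [rewrite Hs, Cmod_R; lra | unfold I01; lra].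
- rewrite Rabs_minus_sym, (Rabs_pos_eq (1 - x)) in * by (unfold I01 in Hx; lra).
  unfold I01 in Hx.
  apply (Rmult_lt_compat_l (1 + M)) in Hxd; [| lra].
  replace ((1 + M) * (eps / (1 + M))) with eps in Hxd by (field; lra).
  nra.
Qed.

(** * Nonvanishing at the right endpoint and the algebra of the functionals *)

(** If both data vanished at 1, backward uniqueness would give [sin beta = cos beta = 0], against
    the Pythagorean identity. *)
Lemma eigenfun_end_nonzero (q : R -> R) (beta : R) (y : R -> C -> C) (lam : C) :
  continuous_on I01 q -> is_initial_solution q beta y ->
  y 1 lam = RtoC 0 -> derive01 (fun x => y x lam) 1 <> RtoC 0.
Proof.
intros Hq Hy E1 E2.
destruct (continuous_on_bounded q Hq) as [Q0 [HQ0 Hq0]].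
destruct (Hy lam) as [Hs [Hsin Hcos]].
destruct (solves_SL_sol _ _ _ Hs) as [H1 [f2 [H2 H3]]].
pose proof (Cmod_ge_0 lam).
destruct (ode_backward_unique (fun x => y x lam) (derive01 (fun x => y x lam)) f2
  (Q0 + Cmod lam)) as [A1 A2]; auto; try lra.
- intros x Hx; rewrite H3 by auto.
  replace ((RtoC (q x) - lam) * y x lam - RtoC 0)%C
    with ((RtoC (q x) + - lam) * y x lam)%C by ring.
  rewrite Cmod_mult; apply Rmult_le_compat_r; [apply Cmod_ge_0 |].
  eapply Rle_trans; [apply Cmod_triangle |].
  rewrite Cmod_opp, Cmod_R; apply Rplus_le_compat_r, Hq0; unfold I01; lra.
- rewrite Hsin in A1; rewrite Hcos in A2.
  apply RtoC_inj in A1, A2.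
  pose proof (sin2_cos2 beta) as T; rewrite A1, A2 in T.
  unfold Rsqr in T; lra.
Qed.

Lemma is_derive01_add_scal (f g : R -> C) (x : R) (l m z : C) :
  I01 x -> is_derive01 f x l -> is_derive01 g x m ->
  is_derive01 (fun t => f t + z * g t)%C x (l + z * m)%C.
Proof.
intros Hx Hf Hg.
replace (l + z * m)%C with (RtoC 1 * l + z * m)%C by ring.
apply is_derive01_ext with (fun t => RtoC 1 * f t + z * g t)%C; auto.
- intros; ring.
- now apply is_derive01_lin.
Qed.

(** The correction term of [frakA1] depends on [y0] alone, so only the leading term sees the added
    multiple. Differentiability makes the total operator [derive01] additive here. *)
Lemma frakA1_add (a b c d : R) (lam0 z : C) (y0 f : R -> C) :
  ex_derive01 y0 1 -> ex_derive01 f 1 ->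
  frakA1 a b c d lam0 y0 (fun x => f x + z * y0 x)%C =
  (frakA1 a b c d lam0 y0 f + z * frakA0 a b c d lam0 y0)%C.
Proof.
intros [m Hm] [l Hl].
assert (I1 : I01 1) by (unfold I01; lra).
unfold frakA1, frakA0; destruct Ceq_dec.
- rewrite (is_derive01_unique _ _ _ I1 (is_derive01_add_scal _ _ _ _ _ z I1 Hl Hm)).
  rewrite (is_derive01_unique _ _ _ I1 Hl), (is_derive01_unique _ _ _ I1 Hm).
  unfold Cdiv; ring.
- unfold Cdiv; ring.
Qed.

Lemma Cdiv_neq_0 (z w : C) :
  z <> RtoC 0 -> w <> RtoC 0 -> (z / w)%C <> RtoC 0.
Proof.
intros Hz Hw E; apply Hz.
replace z with (z / w * w)%C by (field; auto); rewrite E; ring.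
Qed.

(** In either case, a vanishing numerator would make both data of the eigenfunction vanish at 1,
    through the boundary condition. *)
Lemma frakA0_eigenfun_nonzero (q : R -> R) (a b c d beta : R)
    (y : R -> C -> C) (lam0 : C) :
  continuous_on I01 q -> is_initial_solution q beta y ->
  a * d - b * c <> 0 -> char_fun a b c d y lam0 = RtoC 0 ->
  frakA0 a b c d lam0 (eigenfun y lam0) <> RtoC 0.
Proof.
intros Hq Hy Habcd Hw.
assert (Hend := eigenfun_end_nonzero q beta y lam0 Hq Hy).
unfold char_fun in Hw; unfold frakA0, eigenfun.
set (p := (RtoC a * lam0 + RtoC b)%C) in *.
set (r := (RtoC c * lam0 + RtoC d)%C) in *.
destruct (Ceq_dec r (RtoC 0)) as [Hr | Hr].
- assert (Hp : p <> RtoC 0).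
  (* [p] and [r] cannot both vanish, because [a r - c p = a d - b c]. *)
  { intros Hp; apply Habcd, RtoC_inj.
    rewrite RtoC_minus, !RtoC_mult.
    replace (RtoC a * RtoC d - RtoC b * RtoC c)%C
      with (RtoC a * r - RtoC c * p)%C by (unfold r, p; ring).
    rewrite Hr, Hp; ring. }
  assert (E : y 1 lam0 = RtoC 0).
  { destruct (Ceq_dec (y 1 lam0) (RtoC 0)) as [E | E]; auto.
    exfalso; apply (Cmult_neq_0 _ _ Hp E); rewrite <- Hw, Hr; ring. }
  apply Cdiv_neq_0; auto.
- apply Cdiv_neq_0; auto.
  intros E; apply (Cmult_neq_0 _ _ Hr (Hend E)).
  replace (r * derive01 (fun x => y x lam0) 1)%C with
    (p * y 1%R lam0 - (p * y 1%R lam0 - r * derive01 (fun x => y x lam0) 1))%C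
    by ring.
  rewrite Hw, E; ring.
Qed.

Theorem theorem3p1 (q : R -> R) (a b c d beta : R) (y : R -> C -> C)
    (lam0 K : C)
    (hq : continuous_on I01 q)
    (habcd : a * d - b * c < 0)
    (hbeta : 0 <= beta < PI)
    (hy : is_initial_solution q beta y)
    (hlam0 : double_eigenvalue a b c d y lam0) :
  frakA1 a b c d lam0 (eigenfun y lam0) (y1star a b c d y lam0 K) = RtoC 0
  <->
  K = (- (C_derive_n 3 (char_fun a b c d y) lam0
          / (RtoC 3 * C_derive_n 2 (char_fun a b c d y) lam0)))%C.
Proof.
destruct hlam0 as [Hw [_ Hw2]].
assert (HA := frakA0_eigenfun_nonzero q a b c d beta y lam0 hq hy
  (Rlt_not_eq _ _ habcd) Hw).
assert (I1 : I01 1) by (unfold I01; lra).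
assert (Dy0 : ex_derive01 (eigenfun y lam0) 1) by (apply (hy lam0), I1).
assert (Dyt := ytilde1_ex_derive01 q beta y lam0 hq hy).
assert (Dy1 : ex_derive01 (assoc_fun y lam0 K) 1).
{ destruct Dy0 as [m Hm], Dyt as [l Hl]; eexists.
  exact (is_derive01_add_scal _ _ _ _ _ K I1 Hl Hm). }
(* The three expansions express everything by [At], the value at [ytilde1], and [A0]: the value at
   [y1star] is [At + K A0 + C1 A0], and the one at [yhat1] is [At + 2 K A0]. *)
unfold y1star; rewrite frakA1_add by auto.
unfold const_C1, yhat1; rewrite frakA1_add by auto.
unfold assoc_fun; rewrite frakA1_add by auto.
set (At := frakA1 _ _ _ _ _ _ _); set (A0 := frakA0 _ _ _ _ _ _) in *.
set (w2 := C_derive_n 2 _ _) in *; set (w3 := C_derive_n 3 _ _).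
assert (N : forall t, t <> 0 -> RtoC t <> RtoC 0)
  by (intros t Ht E; now apply Ht, RtoC_inj).
assert (N2 := N 2 ltac:(lra)); assert (N3 := N 3 ltac:(lra));
  assert (N6 := N 6 ltac:(lra)).
assert (E36 : RtoC 6 = (RtoC 2 * RtoC 3)%C)
  by (rewrite <- RtoC_mult; f_equal; ring).
(* On inserting [C1] the term [At] cancels and [K - 2K] leaves [-K]; the factor 1/3 is the quotient
   of 1/6 by 1/2. *)
match goal with |- ?l = _ <-> _ =>
  replace l with (- A0 * (K - - (w3 / (RtoC 3 * w2))))%C
    by (rewrite E36; field; repeat split; auto) end.
split.
- intros E; apply Ceq_minus.
  destruct (Ceq_dec (K - - (w3 / (RtoC 3 * w2)))%C (RtoC 0)) as [E' | E']; auto.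
  exfalso; refine (Cmult_neq_0 _ _ _ E' E).
  intros E0; apply HA; replace A0 with (- - A0)%C by ring; rewrite E0; ring.
- intros ->; ring.
Qed.
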